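(* Let $R$ be a supertropical semiring, $n\ge 1$, $m\ge 2$, and let $f_1,\dots,f_m\in \mathrm{Fun}(R^{(n)},R)$, $f=\sum_{i=1}^m f_i$. Then $$\prod_{1\le i<j\le m}(f_i+f_j)=g_1g_2\cdots g_{m-1},$$ where $g_1=f=\sum_i f_i$, $g_2=\sum_{i<j}f_if_j$, $\dots$, $g_{m-1}=\sum_i\prod_{j\ne i}f_j$; that is, $g_k=\sum_{i_1<\cdots<i_k}f_{i_1}\cdots f_{i_k}$ for $1\le k\le m-1$.
   Context: All semirings are commutative (in both operations), with zero $0_R$ and unit $1_R$. A supertropical semiring is a triple $(R,\mathcal G_0,\nu)$ where $R$ is a semiring, $\mathcal G_0=\mathcal G\cup\{0_R\}$ is a semiring ideal of $R$ (the ghost ideal), and $\nu:R\to\mathcal G_0$ (written $a^\nu=\nu(a)$) is a semiring homomorphism with $\nu^2=\nu$ (where $\mathcal G_0$ is a semiring with unit $\nu(1_R)$), such that: $a+a=a^\nu$ for all $a$; $a+b\in\{a,b\}$ whenever $a^\nu\ne b^\nu$; and $a+b=a^\nu$ whenever $a^\nu=b^\nu$. $\mathrm{Fun}(R^{(n)},R)$ is the semiring of all functions from the Cartesian power $R^{(n)}$ to $R$ under pointwise addition and multiplication. *)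

(* Defs.v *)
From HB Require Import structures.
From mathcomp Require Import all_boot all_order all_algebra.
From mathcomp Require Import boolp classical_sets functions.

Set Implicit Arguments.
Unset Strict Implicit.
Unset Printing Implicit Defensive.

Import GRing.Theory.
Local Open Scope ring_scope.

(* [ghost] is the ghost ideal G_0, which contains 0. The map [nu] goes from R
   to the semiring G_0, whose unit is [nu 1] rather than 1, so it is not an
   {rmorphism R -> R}. Semirings are allowed to be trivial (1 = 0). *)
HB.mixin Record isSupertropical R of GRing.ComPzSemiRing R := {
  ghost : set R;
  nu : R -> R;
  ghost0 : ghost 0;
  ghostD : forall a b, ghost a -> ghost b -> ghost (a + b);
  ghostMl : forall a b, ghost b -> ghost (a * b);
  nu_ghost : forall a, ghost (nu a);
  ghost_mul1 : forall a, ghost a -> nu 1 * a = a;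
  nu0 : nu 0 = 0;
  nuD : {morph nu : a b / a + b};
  nuM : {morph nu : a b / a * b};
  nu_idem : forall a, nu (nu a) = nu a;
  addrr_nu : forall a, a + a = nu a;
  addr_bipotent : forall a b, nu a <> nu b -> a + b = a \/ a + b = b;
  addr_nu_eq : forall a b, nu a = nu b -> a + b = nu a
}.

#[short(type="supertropicalType")]
HB.structure Definition Supertropical :=
  { R of GRing.ComPzSemiRing R & isSupertropical R }.

Definition powFun (n : nat) (R : Type) : Type := n.-tuple R -> R.

Section PowFunSemiRing.
Variables (n : nat) (R : comPzSemiRingType).
Implicit Types f g h : n.-tuple R -> R.

(* The library has the pointwise sum on function types, but the pointwise
   product only over rings. *)
HB.instance Definition _ := GRing.Nmodule.copy (powFun n R) (n.-tuple R -> R).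

Let mulA : associative (fun f g => f \* g).
Proof. by move=> f g h; apply/funext => x /=; rewrite mulrA. Qed.

Let mulC : commutative (fun f g => f \* g).
Proof. by move=> f g; apply/funext => x /=; rewrite mulrC. Qed.

Let mul1 : left_id (fun=> 1) (fun f g => f \* g).
Proof. by move=> f; apply/funext => x /=; rewrite mul1r. Qed.

Let mulDl : left_distributive (fun f g => f \* g) (fun f g => f \+ g).
Proof. by move=> f g h; apply/funext => x /=; rewrite mulrDl. Qed.

Let mul0 : left_zero (fun=> 0) (fun f g => f \* g).
Proof. by move=> f; apply/funext => x /=; rewrite mul0r. Qed.

HB.instance Definition _ :=
  GRing.Nmodule_isComPzSemiRing.Build (powFun n R) mulA mulC mul1 mulDl mul0.

Lemma powFunD (f g : powFun n R) x : (f + g) x = f x + g x.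
Proof. by []. Qed.

Lemma powFunM (f g : powFun n R) x : (f * g) x = f x * g x.
Proof. by []. Qed.

End PowFunSemiRing.

(* Index sequences i_1 < ... < i_k are encoded as k-element subsets. *)
Definition elem_sym (S : comPzSemiRingType) (m : nat) (f : 'I_m -> S) (k : nat) : S :=
  \sum_(A : {set 'I_m} | #|A| == k) \prod_(i in A) f i.

(* Main.v *)
Require Import Defs.
From mathcomp Require Import all_boot all_order all_algebra.
From mathcomp Require Import boolp.

Set Implicit Arguments.
Unset Strict Implicit.
Unset Printing Implicit Defensive.

Import GRing.Theory.
Local Open Scope ring_scope.

(** Pointwise evaluation reduces the identity to one about finitely many
    elements [f i] of a supertropical semiring, and there it is proved by
    induction on the index set, removing an index [i] whose value is minimal
    for the total preorder that compares ghost values.  Write [A] for the set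
    of remaining indices and [e_k] for elementary symmetric functions.

    Everything rests on [add_below2]: if [b] lies below both [c] and [d], then
    [b + c + d = c + d].  Either [b] is strictly below one of them and is
    swallowed by it, or all three have the same ghost value and both sides are
    that ghost.  One summand is not enough, since [b + c] differs from [c] when
    [c] is tangible and [b], [c] have the same ghost value.

    Consequently a monomial [f i * \prod_(j in B) f j] with [B] inside [A] is
    absorbed by [e_(#|B| + 1)] of [A] as soon as [A] has two indices [c], [d]
    outside [B] ([absorb_monomial]): the two monomials with [f c] and [f d] in
    place of [f i] are both present.  This has two effects.  First, passing
    from [A] to [i |: A] does not change [e_k] for [k < #|A|] ([esum_minU]).
    Second, when [\prod_(j in A) (f i + f j)] is expanded, the terms with at
    least two factors [f i] are absorbed, which leaves exactly [e_#|A|] of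
    [i |: A] ([prod_min_addE]).  So adjoining [i] to [A] multiplies both
    sides of the identity by the same factor, namely [e_#|A|] of [i |: A]. *)

(** * The ghost preorder *)

Section GhostOrder.
Variable R : supertropicalType.
Implicit Types a b c d : R.

Definition ghost_le b c : bool := nu b + nu c == nu c.

Lemma ghost_le_refl : reflexive ghost_le.
Proof. by move=> a; rewrite /ghost_le addrr_nu nu_idem. Qed.

Lemma ghost_le_trans : transitive ghost_le.
Proof.
by move=> b a c /eqP ab /eqP bc; rewrite /ghost_le -bc addrA ab.
Qed.

Lemma ghost_le_total : total ghost_le.
Proof.
move=> a b; rewrite /ghost_le (addrC (nu b)).
have [ab|/eqP ab] := eqVneq (nu a) (nu b).
  by rewrite ab addrr_nu nu_idem eqxx.
have [|->|->] := addr_bipotent (nu a) (nu b); rewrite ?eqxx ?orbT //.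
by rewrite !nu_idem.
Qed.

Lemma add_strictly_below b c : ghost_le b c -> nu b <> nu c -> b + c = c.
Proof.
move=> /eqP bc ne; have [E|//] := addr_bipotent b c ne.
by case: ne; rewrite -bc -nuD E.
Qed.

(** Two upper bounds are what makes absorption unconditional: if [b], [c] and
    [d] all have the same ghost value, then [c + d] is already a ghost. *)
Lemma add_below2 b c d :
  ghost_le b c -> ghost_le b d -> b + (c + d) = c + d.
Proof.
move=> bc bd.
have [ebc|/eqP nbc] := eqVneq (nu b) (nu c); last first.
  by rewrite addrA (add_strictly_below bc nbc).
have [ebd|/eqP nbd] := eqVneq (nu b) (nu d); last first.
  by rewrite addrCA (add_strictly_below bd nbd).
rewrite (addr_nu_eq c d) -?ebc ?ebd // (addr_nu_eq b) ?nu_idem //.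
Qed.

End GhostOrder.

(** * Elementary symmetric functions over subsets *)

Section SubsetSums.
Variables (S : comPzSemiRingType) (T : finType) (f : T -> S).
Implicit Types (A B : {set T}) (i : T) (k : nat).

Definition esum A k : S :=
  \sum_(B : {set T} | (B \subset A) && (#|B| == k)) \prod_(i in B) f i.

Lemma esum0 A : esum A 0 = 1.
Proof.
rewrite /esum (big_pred1 set0) ?big_set0 // => B.
by rewrite cards_eq0 andbC /=; have [->|] := eqVneq B set0; rewrite ?sub0set.
Qed.

Lemma esum_gt_card A k : (#|A| < k)%N -> esum A k = 0.
Proof.
move=> lt; rewrite /esum big1 // => B /andP[/subset_leq_card le /eqP kB].
by move: lt; rewrite -kB ltnNge le.
Qed.

(** Subsets of [i |: A] of size [k.+1] either avoid [i], or are obtained by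
    adding [i] to a subset of [A] of size [k]. *)
Lemma esumU1 i A k : i \notin A ->
  esum (i |: A) k.+1 = esum A k.+1 + f i * esum A k.
Proof.
move=> iA; rewrite /esum (bigID (fun B => i \in B)) /= addrC; congr (_ + _).
  apply: eq_bigl => B; case iB: (i \in B) => /=.
    rewrite andbF; symmetry; apply/negP => /andP[/subsetP/(_ i iB)].
    by rewrite (negPf iA).
  rewrite andbT; congr (_ && _); apply/idP/idP => [/subsetP sB|sB].
    apply/subsetP => j jB; have := sB j jB; rewrite !inE => /predU1P[E|//].
    by rewrite -E jB in iB.
  exact: subset_trans sB (subsetUr _ _).
rewrite big_distrr /=.
rewrite (reindex_onto (fun B => i |: B) (fun B => B :\ i)) /=; last first.
  by move=> B /andP[_]; exact: setD1K.
apply: eq_big => [B|B].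
  case iB: (i \in B).
    have -> /= : ((i |: B) :\ i == B) = false.
      by apply/eqP => E; have := iB; rewrite -E !inE eqxx.
    rewrite andbF; symmetry; apply/negP => /andP[/subsetP/(_ i iB)].
    by rewrite (negPf iA).
  rewrite setU1K ?iB // eqxx !inE eqxx cardsU1 iB eqSS !andbT.
  congr (_ && _); apply/idP/idP => [/subsetP sB|sB]; last exact: setUS.
  apply/subsetP => j jB; have := sB j; rewrite !inE jB orbT => /(_ isT).
  by case/predU1P => // E; rewrite -E jB in iB.
case/andP => _ /eqP E; rewrite big_setU1 //=.
by rewrite -E !inE eqxx.
Qed.

Lemma absorb_sum (I : finType) (P : pred I) (F : I -> S) y :
  (forall j, P j -> F j + y = y) -> \sum_(j | P j) F j + y = y.
Proof.
move=> Fy; apply: (big_ind (fun x => x + y = y)) => //; first exact: add0r.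
by move=> a b ay byy; rewrite -addrA byy.
Qed.

End SubsetSums.

Lemma elem_sym_esum (S : comPzSemiRingType) m (f : 'I_m -> S) k :
  elem_sym f k = esum f [set: 'I_m] k.
Proof. by apply: eq_bigl => B; rewrite subsetT. Qed.

(** * Adjoining an index of minimal value *)

Section MinimalIndex.
Variables (R : supertropicalType) (T : finType) (f : T -> R).
Implicit Types (A B : {set T}) (i : T) (k : nat).

Local Notation e := (esum f).
Local Notation below i A := (forall j, j \in A -> ghost_le (f i) (f j)).

(** [k.+1 < #|A|] leaves two indices of [A] outside [B], as [add_below2]
    demands. *)
Lemma absorb_monomial i A B k : below i A ->
    B \subset A -> #|B| = k -> (k.+1 < #|A|)%N ->
  f i * \prod_(j in B) f j + e A k.+1 = e A k.+1.
Proof.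
move=> iA sBA cB ltk.
have : (1 < #|A :\: B|)%N.
  by rewrite cardsD (setIidPr sBA) cB ltn_subRL addn1.
case/card_gt1P => c [d [+ + cd]].
rewrite !inE => /andP[cNB cA] /andP[dNB dA].
have monU j : j \in A -> j \notin B ->
    (j |: B \subset A) && (#|j |: B| == k.+1).
  by move=> jA jNB; rewrite subUset sub1set jA sBA cardsU1 jNB cB eqxx.
have neU : d |: B != c |: B.
  apply/eqP => /setP/(_ d); rewrite !inE eqxx (negPf dNB) orbF eq_sym.
  by rewrite (negPf cd).
rewrite /esum (bigD1 (c |: B)) ?monU //= (bigD1 (d |: B)) ?monU //=.
rewrite !big_setU1 //= 2!addrA -2!mulrDl -(addrA (f i)).
by rewrite add_below2 ?iA // mulrDl addrA.
Qed.

Lemma esum_minU i A k : i \notin A -> below i A -> (k < #|A|)%N ->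
  e (i |: A) k = e A k.
Proof.
case: k => [|k] iNA iA ltk; first by rewrite !esum0.
rewrite esumU1 // addrC {1}/esum big_distrr /=.
by apply: absorb_sum => B /andP[sB /eqP cB]; exact: absorb_monomial.
Qed.

(** Only the terms with at most one factor [f i] survive in the expansion.
    In the induction an index [c] is removed from [A].  Multiplying the value
    for [A' := A :\ c] by [f i + f c] gives the terms wanted for [A] and one
    more, [f i * (f i * e A' (#|A'| - 1))].  The latter is absorbed by
    [f i * e A #|A'|]; this holds monomial by monomial, which is why
    [absorb_monomial] speaks of monomials and not of their sum. *)
Lemma prod_min_addE i A : i \notin A -> below i A ->
  \prod_(j in A) (f i + f j) = e (i |: A) #|A|.
Proof.
move: {2}#|A| (erefl #|A|) => n; elim: n A => [|n IHn] A.
  by move/eqP; rewrite cards_eq0 => /eqP-> _ _; rewrite big_set0 cards0 esum0.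
move=> cA iNA iA; have /card_gt0P[c cinA] : (0 < #|A|)%N by rewrite cA.
pose A' := A :\ c; have cNA' : c \notin A' by rewrite !inE eqxx.
have defA : A = c |: A' by rewrite setD1K.
have cA' : #|A'| = n by apply/eqP; rewrite -eqSS -cA (cardsD1 c A) cinA.
have sA' : A' \subset A by exact: subD1set.
have iNA' : i \notin A' by apply: contra iNA; exact: (subsetP sA').
have iA' : below i A' by move=> j /(subsetP sA'); exact: iA.
rewrite cA esumU1 //.
have -> : \prod_(j in A) (f i + f j) = (f i + f c) * e (i |: A') n.
  by rewrite {1}defA big_setU1 //= IHn // cA'.
have eAtop : e A n.+1 = f c * e A' n.
  by rewrite defA esumU1 // esum_gt_card ?cA' // add0r.
case: n {IHn} => [|n] in cA cA' eAtop *.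
  by rewrite !esum0 eAtop esum0 !mulr1 addrC.
have sq : f i * e A' n + e A n.+1 = e A n.+1.
  rewrite {1}/esum big_distrr /=; apply: absorb_sum => B /andP[sB /eqP cB].
  by apply: absorb_monomial; rewrite ?cA //; exact: subset_trans sB sA'.
have eA : e A n.+1 = e A' n.+1 + f c * e A' n by rewrite defA esumU1.
rewrite esumU1 // eAtop -sq eA !(mulrDl, mulrDr) [LHS]addrCA.
by congr (_ + _); rewrite (mulrCA (f c)) [RHS]addrA (addrC (_ * e A' n.+1)).
Qed.

End MinimalIndex.

(** * The product over pairs *)

(** Commutativity of [F] makes the position of [i] among the other indices
    irrelevant: pairs with [i] on the left and pairs with [i] on the right
    together form one product over [A]. *)
Lemma prod_pairsU1 (S : comPzSemiRingType) m (F : 'I_m -> 'I_m -> S) i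
    (A : {set 'I_m}) : (forall j k, F j k = F k j) -> i \notin A ->
  \prod_(j in i |: A) \prod_(k in i |: A | (j < k)%N) F j k
  = \prod_(k in A) F i k * \prod_(j in A) \prod_(k in A | (j < k)%N) F j k.
Proof.
move=> FC iNA.
have row (j : 'I_m) : \prod_(k in i |: A | (j < k)%N) F j k
    = (if (j < i)%N then F j i else 1) * \prod_(k in A | (j < k)%N) F j k.
  by rewrite !big_mkcondr big_setU1.
rewrite (eq_bigr _ (fun j _ => row j)) big_setU1 //= ltnn mul1r.
rewrite big_split /= mulrA; congr (_ * _).
rewrite -big_mkcondr [RHS](bigID (fun k : 'I_m => (i < k)%N)) /=; congr (_ * _).
apply: eq_big => [k|k _]; last exact: FC.
have [kA|//] := boolP (k \in A); rewrite -leqNgt ltn_neqAle /=.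
have -> // : (k != i :> nat).
by apply: contraNneq iNA => /val_inj <-.
Qed.

Lemma prod_pairs_esum (R : supertropicalType) m (f : 'I_m -> R)
    (A : {set 'I_m}) :
  \prod_(i in A) \prod_(j in A | (i < j)%N) (f i + f j)
  = \prod_(1 <= k < #|A|) esum f A k.
Proof.
move: {2}#|A| (erefl #|A|) => n; elim: n A => [|n IHn] A.
  by move/eqP; rewrite cards_eq0 => /eqP->; rewrite big_set0 cards0 big_geq.
move=> cA; have /card_gt0P[i0 i0A] : (0 < #|A|)%N by rewrite cA.
have [i iA imin] : exists2 i, i \in A &
    forall j, j \in A -> ghost_le (f i) (f j).
  have [i] := fintype.extremumP f (@ghost_le_refl R) (@ghost_le_trans R)
    (@ghost_le_total R) i0A.
  by exists i.
pose A' := A :\ i; have iNA' : i \notin A' by rewrite !inE eqxx.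
have defA : A = i |: A' by rewrite setD1K.
have cA' : #|A'| = n by apply/eqP; rewrite -eqSS -cA (cardsD1 i A) iA.
have min' j : j \in A' -> ghost_le (f i) (f j).
  by rewrite !inE => /andP[_]; exact: imin.
rewrite cA {1 2}defA prod_pairsU1 //; last by move=> j k; rewrite addrC.
rewrite prod_min_addE // IHn // cA' -defA.
case: n {IHn} => [|n] in cA cA' *.
  by rewrite !big_geq // esum0 mulr1.
rewrite [RHS]big_nat_recr //= mulrC; congr (_ * _).
by apply: eq_big_nat => k /andP[_ ltk]; rewrite defA esum_minU ?cA'.
Qed.

(** * Evaluation of functions *)

Lemma powFun_sumE (R : comPzSemiRingType) n (I : Type) (r : seq I) (P : pred I)
    (F : I -> powFun n R) x :
  (\sum_(i <- r | P i) F i) x = \sum_(i <- r | P i) F i x.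
Proof. exact: (big_morph (fun g : powFun n R => g x)). Qed.

Lemma powFun_prodE (R : comPzSemiRingType) n (I : Type) (r : seq I)
    (P : pred I) (F : I -> powFun n R) x :
  (\prod_(i <- r | P i) F i) x = \prod_(i <- r | P i) F i x.
Proof. exact: (big_morph (fun g : powFun n R => g x)). Qed.

Theorem theorem8p53 (R : supertropicalType) (n m : nat)
    (hn : (1 <= n)%N) (hm : (2 <= m)%N) (f : 'I_m -> powFun n R) :
  \prod_(i < m) \prod_(j < m | (i < j)%N) (f i + f j)
  = \prod_(1 <= k < m) elem_sym f k.
Proof.
apply/funext => x; rewrite !powFun_prodE.
have := prod_pairs_esum (fun i => f i x) [set: 'I_m].
rewrite cardsT card_ord => E; transitivity (\prod_(1 <= k < m)
    esum (fun i => f i x) [set: 'I_m] k).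
  rewrite -E; apply: eq_big => [i|i _]; first by rewrite inE.
  by rewrite powFun_prodE; apply: eq_bigl => j; rewrite inE.
apply: eq_bigr => k _; rewrite elem_sym_esum /esum powFun_sumE.
by apply: eq_bigr => B _; rewrite powFun_prodE.
Qed.
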